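(* Let $f,g:\mathbb{R}^n\to(-\infty,+\infty]$ be proper, lower semicontinuous and prox-bounded with thresholds $\lambda_f,\lambda_g>0$, let $0<\mu<\bar\lambda=\min\{\lambda_f,\lambda_g\}$, $\alpha\in[0,1]$, and let $\varphi^{\alpha}_{\mu}=-e_{\mu}(-\alpha e_{\mu}f-(1-\alpha)e_{\mu}g)$. Suppose that either $f$ or $g$ is almost differentiable (in particular, if $f$ or $g$ is differentiable at every point of its domain). Then $\varphi^{\alpha}_{\mu}$ is almost differentiable. In particular, $\varphi^{\alpha}_{\mu}$ is differentiable on the interior of its domain $\operatorname{int}\operatorname{dom}\varphi^{\alpha}_{\mu}$.
   Context: $\|\cdot\|$ is the Euclidean norm. $e_{\mu}f(x)=\inf_{w}\{f(w)+\frac{1}{2\mu}\|w-x\|^2\}$. $f$ is prox-bounded if there exist $\lambda>0$ and $x$ with $e_{\lambda}f(x)>-\infty$; the supremum of all such $\lambda$ is its threshold $\lambda_f\in(0,+\infty]$. The Fréchet subdifferential of $h$ at $x\in\operatorname{dom}h$ is $\hat\partial h(x)=\{s\in\mathbb{R}^n:h(y)\ge h(x)+\langle s,y-x\rangle+o(\|y-x\|)\}$. A function $h:\mathbb{R}^n\to(-\infty,+\infty]$ is almost differentiable if $\hat\partial h(x)$ is a singleton for every $x\in\operatorname{int}(\operatorname{dom}h)$ and $\hat\partial h(x)=\varnothing$ for every $x\in\operatorname{dom}h\setminus\operatorname{int}(\operatorname{dom}h)$, if any.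
   Formalization: The almost differentiable function (or the one differentiable on its domain) must have nonzero weight: f with α>0, or g with α<1; otherwise the claim fails, e.g. α=0, f=0, g=|·|, μ=1 gives φ=|·|, which is not differentiable at 0. *)

(* Defs.v *)
From HB Require Import structures.
From mathcomp Require Import all_boot all_order all_algebra.
From mathcomp Require Import all_classical all_reals all_analysis.
Import Order.TTheory GRing.Theory Num.Theory.
Import numFieldNormedType.Exports.

Set Implicit Arguments.
Unset Strict Implicit.
Unset Printing Implicit Defensive.

Local Open Scope classical_set_scope.
Local Open Scope ring_scope.

(* The library norm on ['rV[R]_n] is the sup norm (it induces the same topology
   and the same notion of differentiability), so the Euclidean inner product
   and norm are defined separately. *)
Definition dotp (R : realType) (n : nat) (u v : 'rV[R]_n) : R :=
  \sum_(i < n) u ord0 i * v ord0 i.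

Definition enorm (R : realType) (n : nat) (u : 'rV[R]_n) : R :=
  Num.sqrt (dotp u u).

Definition edom (R : realType) (n : nat) (h : 'rV[R]_n -> \bar R) :
    set 'rV[R]_n :=
  [set x | (h x < +oo)%E].

Definition proper_efun (R : realType) (n : nat) (h : 'rV[R]_n -> \bar R) : Prop :=
  (forall x, (-oo < h x)%E) /\ edom h !=set0.

Definition moreau_env (R : realType) (n : nat) (mu : R)
    (f : 'rV[R]_n -> \bar R) (x : 'rV[R]_n) : \bar R :=
  ereal_inf (range (fun w : 'rV[R]_n =>
    (f w + ((2 * mu)^-1 * enorm (w - x) ^+ 2)%:E)%E)).

Definition prox_radii (R : realType) (n : nat) (f : 'rV[R]_n -> \bar R) :
    set R :=
  [set lambda | 0 < lambda /\ exists x, (-oo < moreau_env lambda f x)%E].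

Definition prox_bounded (R : realType) (n : nat) (f : 'rV[R]_n -> \bar R) :
    Prop :=
  prox_radii f !=set0.

Definition prox_threshold (R : realType) (n : nat) (f : 'rV[R]_n -> \bar R) :
    \bar R :=
  ereal_sup (EFin @` prox_radii f).

(* For [x] in [edom h]; the error term [o(|y - x|)] is a one-sided bound by
   [eps * |y - x|] near [x], for every [eps > 0]. *)
Definition frechet_subdiff (R : realType) (n : nat) (h : 'rV[R]_n -> \bar R)
    (x : 'rV[R]_n) : set 'rV[R]_n :=
  [set s | forall eps : R, 0 < eps -> \forall y \near x,
    (h x + (dotp s (y - x) - eps * enorm (y - x))%:E <= h y)%E].

Definition almost_differentiable (R : realType) (n : nat)
    (h : 'rV[R]_n -> \bar R) : Prop :=
  [/\ forall x, (-oo < h x)%E,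
      forall x, (edom h)° x -> exists s, frechet_subdiff h x = [set s] &
      forall x, (edom h `\` (edom h)°) x -> frechet_subdiff h x = set0].

(* Differentiability of an extended-real-valued function at a point presupposes
   that the function is finite around that point. *)
Definition differentiable_at (R : realType) (n : nat)
    (h : 'rV[R]_n -> \bar R) (x : 'rV[R]_n) : Prop :=
  (\forall y \near x, h y \is a fin_num) /\
  differentiable (fun y => fine (h y)) x.

Definition nc_prox_average (R : realType) (n : nat) (mu alpha : R)
    (f g : 'rV[R]_n -> \bar R) (x : 'rV[R]_n) : \bar R :=
  (- moreau_env mu (fun w => - (alpha%:E * moreau_env mu f w)
                             - (1 - alpha)%:E * moreau_env mu g w) x)%E.

(* Main.v *)
From HB Require Import structures.
Require Import Defs.
From mathcomp Require Import all_boot all_order all_algebra.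
From mathcomp Require Import all_classical all_reals all_analysis.
From mathcomp Require Import finmap ring lra.
Import Order.TTheory GRing.Theory Num.Theory.
Import numFieldNormedType.Exports.
Set Implicit Arguments.
Unset Strict Implicit.

Local Open Scope classical_set_scope.
Local Open Scope ring_scope.

(* Set H w = |w|^2 / 2 - mu (alpha e_mu f w + (1 - alpha) e_mu g w).  Then
   mu phi x + |x|^2 / 2 is the Fenchel conjugate sup_w (<w, x> - H w), and H is a
   convex combination of two convex functions, each having the proximal points
   as subgradients.  If f has at most one Frechet subgradient at each point of
   its domain, no proximal point is shared by two distinct points, and this
   makes H strictly midpoint convex (as soon as alpha > 0).

   A Frechet subgradient s of phi at x amounts to a minimizer w = x + mu s of
   H - <., x>.  By strict convexity this minimizer is unique, and by compactness
   of spheres H - <., x> then grows linearly away from w; hence phi is finite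
   near x and differentiable at x with gradient (w - x) / mu.  At an interior
   point of the domain of phi, H - <., x> is coercive, so a minimizer exists. *)

(** * Euclidean inner product and its comparison with the sup norm *)

Section DotProduct.
Context {R : realType} {n : nat}.
Implicit Types u v w : 'rV[R]_n.

Lemma dotpC u v : dotp u v = dotp v u.
Proof. by apply: eq_bigr => i _; rewrite mulrC. Qed.

Lemma dotpDl u v w : dotp (u + v) w = dotp u w + dotp v w.
Proof. by rewrite -big_split; apply: eq_bigr => i _; rewrite mxE mulrDl. Qed.

Lemma dotpDr u v w : dotp u (v + w) = dotp u v + dotp u w.
Proof. by rewrite dotpC dotpDl !(dotpC u). Qed.

Lemma dotpZl (a : R) u v : dotp (a *: u) v = a * dotp u v.
Proof. by rewrite mulr_sumr; apply: eq_bigr => i _; rewrite mxE mulrA. Qed.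

Lemma dotpZr (a : R) u v : dotp u (a *: v) = a * dotp u v.
Proof. by rewrite dotpC dotpZl dotpC. Qed.

Lemma dotpNl u v : dotp (- u) v = - dotp u v.
Proof. by rewrite -scaleN1r dotpZl mulN1r. Qed.

Lemma dotpNr u v : dotp u (- v) = - dotp u v.
Proof. by rewrite dotpC dotpNl dotpC. Qed.

Definition dotpE := (dotpDl, dotpDr, dotpNl, dotpNr, dotpZl, dotpZr).

Lemma dotp_ge0 u : 0 <= dotp u u.
Proof. by apply: sumr_ge0 => i _; rewrite -expr2 sqr_ge0. Qed.

Lemma enorm_ge0 u : 0 <= enorm u.
Proof. exact: sqrtr_ge0. Qed.

Lemma sqr_enorm u : enorm u ^+ 2 = dotp u u.
Proof. by rewrite sqr_sqrtr ?dotp_ge0. Qed.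

Lemma enormZ (a : R) u : 0 <= a -> enorm (a *: u) = a * enorm u.
Proof.
move=> a0; rewrite /enorm dotpZl dotpZr mulrA sqrtrM ?mulr_ge0//.
by rewrite -expr2 sqrtr_sqr ger0_norm.
Qed.

Lemma norm_coord u i : `|u ord0 i| <= `|u|.
Proof.
rewrite [leRHS]mx_normrE.
by apply/bigmax_geP; right; exists (ord0, i).
Qed.

(** A crude form of Cauchy-Schwarz in the sup norm: each of the [n] products is at most [|u| |v|].
    The factor [n] is absorbed later in arbitrarily small constants. *)
Lemma dotp_le_norm u v : dotp u v <= n%:R * (`|u| * `|v|).
Proof.
rewrite -mulr_natl mulr1 -[n in n%:R]card_ord -sumr_const mulr_suml.
apply: ler_sum => i _; rewrite mul1r.
apply: le_trans (ler_norm _) _.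
by rewrite normrM ler_pM ?norm_coord.
Qed.

Lemma norm_le_coord u (M : R) :
  0 <= M -> (forall i, `|u ord0 i| <= M) -> `|u| <= M.
Proof.
move=> M0 uM; rewrite [leLHS]mx_normrE; apply/bigmax_leP; split => // -[i j] _.
by rewrite /= (ord1 i).
Qed.

Lemma sqr_norm_le_dotp u : `|u| ^+ 2 <= dotp u u.
Proof.
rewrite -[leRHS]sqr_sqrtr ?dotp_ge0// ler_pXn2r ?nnegrE ?sqrtr_ge0//.
apply: norm_le_coord => [|i]; first exact: sqrtr_ge0.
rewrite -sqrtr_sqr ler_wsqrtr// /dotp (bigD1 i)//= -expr2 lerDl.
by apply: sumr_ge0 => j _; rewrite -expr2 sqr_ge0.
Qed.

Lemma norm_le_enorm u : `|u| <= enorm u.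
Proof.
by rewrite -(@ler_pXn2r _ 2) ?nnegrE ?enorm_ge0// sqr_enorm sqr_norm_le_dotp.
Qed.

Lemma dotp_eq0 u : dotp u u = 0 -> u = 0.
Proof.
move=> u0; apply/eqP; rewrite -normr_le0 -[leRHS]sqrtr0 -u0.
exact: norm_le_enorm.
Qed.

End DotProduct.

Lemma enorm_le_norm {R : realType} {n : nat} (u : 'rV[R]_n) :
  enorm u <= n%:R * `|u|.
Proof.
case: n u => [|m] u.
  by rewrite /enorm /dotp big_ord0 sqrtr0 mul0r.
have nu0 : 0 <= m.+1%:R * `|u| by rewrite mulr_ge0.
rewrite -(@ler_pXn2r _ 2) ?nnegrE ?enorm_ge0// sqr_enorm.
apply: le_trans (dotp_le_norm u u) _.
rewrite exprMn -expr2 ler_wpM2r ?exprn_ge0//.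
by rewrite expr2 ler_peMl ?ler1n.
Qed.

(* If no point of [A] were a minimum, the open sets [F y < F x] for [y] in [A]
   would cover [A]; the smallest [F y] in a finite subcover is not covered. *)
Lemma compact_lsc_min {R : realType} {T : ptopologicalType} (A : set T)
    (F : T -> \bar R) :
  compact A -> A !=set0 -> lower_semicontinuous F ->
  exists2 x, A x & forall y, A y -> (F x <= F y)%E.
Proof.
move=> cA [a Aa] lscF; apply: contrapT => /forall2NP nomin.
have oF y : open [set x | (F y < F x)%E].
  case: (F y) => [r| |].
  - by move/lower_semicontinuousP : lscF; exact.
  - rewrite (_ : [set _ | _] = set0); first exact: open0.
    by apply/seteqP; split=> // x /=; rewrite ltNge leey.
  - rewrite (_ : [set _ | _] = \bigcup_(r in [set: R]) [set x | (r%:E < F x)%E]).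
      apply: bigcup_open => r _; move/lower_semicontinuousP : lscF; exact.
    apply/seteqP; split=> [x /= xNy|x [r _ /=]]; last exact: lt_trans (ltNyr r).
    case Fx: (F x) xNy => [s| |]// _; last by exists 0; rewrite //= Fx ltry.
    by exists (s - 1); rewrite //= Fx lte_fin ltrBlDr ltrDl.
have nonmin y : A y -> exists2 z, A z & (F z < F y)%E.
  move=> Ay; case: (nomin y) => // /existsNP[z /not_implyP[Az /negP]].
  by rewrite -ltNge => Fzy; exists z.
move: cA; rewrite compact_cover => /(_ T A (fun y => [set x | (F y < F x)%E])).
case=> [i _ //|x /nonmin[z Az Fzx]|D DA AD]; first by exists z.
have [b Db _] := AD a Aa.
case: (@arg_minP _ _ D (FSetSub Db) xpredT (fun i => F (val i)) isT) => i _ imin.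
have /DA/set_mem/AD[z /= Dz] : val i \in D by exact: valP.
by rewrite ltNge (imin (FSetSub Dz) isT).
Qed.

Lemma near_norm_le {R : realType} {n : nat} (x : 'rV[R]_n) (k c : R) :
  0 <= k -> 0 < c -> \forall y \near x, k * `|y - x| <= c.
Proof.
(* Dividing by [k + 1] covers [k = 0] as well. *)
move=> k0 c0; apply/nbhs_ballP; exists (c / (k + 1)).
  by rewrite /= divr_gt0 ?ltr_wpDl.
move=> y; rewrite -ball_normE /= distrC ltr_pdivlMr ?ltr_wpDl// => /ltW.
by apply: le_trans; rewrite mulrC ler_wpM2l ?lerDl.
Qed.

Lemma continuous_norm_sub {R : realType} {n : nat} (w : 'rV[R]_n) :
  continuous (fun v : 'rV[R]_n => `|v - w|).
Proof.
move=> v; apply: (@continuous_comp 'rV[R]_n 'rV[R]_n R (fun v => v - w)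
  (fun v => `|v|)); last exact: norm_continuous.
by apply: (@continuousB _ _ _ id (cst w)); [exact: cvg_id|exact: cst_continuous].
Qed.

(** * Minimizers of a convex function minus a linear form *)

Section TiltedMinimum.
Context {R : realType} {n : nat} (H : 'rV[R]_n -> R).
Implicit Types w x y : 'rV[R]_n.

(** For a finite function on the whole space this is convexity, in the form that proximal points
    provide directly. *)
Definition subdifferentiable :=
  forall w, exists y, forall w', H w + dotp y (w' - w) <= H w'.

Definition strictly_midconvex :=
  forall w1 w2, w1 != w2 -> H (2^-1 *: (w1 + w2)) < (H w1 + H w2) / 2.

(** Equivalently, [x] is a subgradient of [H] at [w]: the conjugate of [H] at [x] is attained at
    [w]. *)
Definition tilt_min x w := forall w', H w - dotp w x <= H w' - dotp w' x.

Hypothesis subH : subdifferentiable.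

(** In the weighted sum of the subgradient inequalities at the intermediate point, the linear terms
    cancel. *)
Lemma subdifferentiable_convex (t : R) w w' : 0 <= t <= 1 ->
  H (w + t *: (w' - w)) <= (1 - t) * H w + t * H w'.
Proof.
move=> t01; have [y sy] := subH (w + t *: (w' - w)).
have := sy w; have := sy w'; rewrite !dotpE.
move: (H _) (H w) (H w') (dotp y w) (dotp y w') => h a b c d.
nra.
Qed.

(** A subgradient [y] at [w] bounds the decrease from [w] to [v] by [k |v - w|], where
    [k = n |x - y|]. *)
Lemma subdifferentiable_tilt_lsc x :
  lower_semicontinuous (fun w => (H w - dotp w x)%:E).
Proof.
move=> w a; rewrite lte_fin => aw; have [y sy] := subH w.
pose k := n%:R * `|x - y|.
have k0 : 0 <= k by rewrite mulr_ge0.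
pose r := (H w - dotp w x - a) / (k + 1).
have r0 : 0 < r by rewrite divr_gt0 ?subr_gt0// ltr_wpDl.
exists (ball w r); first exact: nbhsx_ballx.
move=> v; rewrite -ball_normE /= distrC => vw; rewrite lte_fin.
have kv : k * `|v - w| < H w - dotp w x - a.
  apply: (@le_lt_trans _ _ ((k + 1) * `|v - w|)); first by rewrite ler_wpM2r ?lerDl.
  by rewrite mulrC -ltr_pdivlMr ?ltr_wpDl.
have := sy v; have := dotp_le_norm (x - y) (v - w).
rewrite mulrA -/k (dotpC w) (dotpC v) in aw kv *; rewrite !dotpE; lra.
Qed.

Lemma tilt_min_growth x w (eps : R) : strictly_midconvex -> tilt_min x w ->
  0 < eps -> exists2 c, 0 < c & forall w', eps <= `|w' - w| ->
    H w - dotp w x + c * `|w' - w| <= H w' - dotp w' x.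
Proof.
move=> scH wmin eps0.
pose S := [set w' | `|w' - w| = eps].
have proj w' : eps <= `|w' - w| -> S (w + (eps / `|w' - w|) *: (w' - w)).
  move=> ew; have w0 : 0 < `|w' - w| by exact: lt_le_trans ew.
  rewrite /S/= addrC addKr mx_normZ normrM normfV normr_id (gtr0_norm eps0).
  by rewrite divfK ?gt_eqF.
(* The sphere is empty only in dimension 0, where no [w'] is at distance [eps] from [w]. *)
have [S0|/set0P/negP/negPn/eqP S0] := pselect (S !=set0); last first.
  by exists 1 => // w' /proj; rewrite S0.
have cS : compact S.
  apply: bounded_closed_compact.
    exists (eps + `|w|); split; first exact: num_real.
    move=> M ltM v /= Sv; rewrite -(subrK w v) (le_trans (ler_normD _ _))// Sv.
    exact: ltW.
  apply: (@closed_comp _ _ (fun v : 'rV[R]_n => `|v - w|) [set eps]).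
    by move=> v _; exact: continuous_norm_sub.
  exact: closed_eq.
have [p Sp pmin] := compact_lsc_min cS S0 (@subdifferentiable_tilt_lsc x).
have pw : p != w.
  by apply: contraTneq eps0 => pw; rewrite -Sp pw subrr normr0 ltxx.
(* Otherwise strict convexity would put the midpoint of [p] and [w] below the minimum. *)
have Gp : H w - dotp w x < H p - dotp p x.
  have := scH _ _ pw; have := wmin (2^-1 *: (p + w)); rewrite !dotpE; lra.
(* This is the least slope from [w] to the sphere; by convexity slopes along a ray from [w] do not
   decrease beyond it. *)
exists ((H p - dotp p x - (H w - dotp w x)) / eps).
  by rewrite divr_gt0 ?subr_gt0.
move=> w' ew; have w0 : 0 < `|w' - w| by exact: lt_le_trans ew.
pose t := eps / `|w' - w|.
have t01 : 0 <= t <= 1.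
  by rewrite divr_ge0 ?(ltW eps0)//= ler_pdivrMr ?mul1r.
have t0 : 0 < t by rewrite divr_gt0.
have := pmin _ (proj _ ew); rewrite lee_fin => Gpt.
have cv := subdifferentiable_convex w w' t01.
have -> : `|w' - w| = eps / t by rewrite /t invf_div mulrCA divff ?mulr1 ?gt_eqF.
rewrite mulrA divfK ?gt_eqF// -lerBrDl ler_pdivrMr//.
move: Gpt cv; rewrite -/t !dotpE; lra.
Qed.

(** Passing from [x] to [y] changes the comparison of [w'] with [w] by [dotp (w' - w) (y - x)]. For
    [w'] within [e] of [w] this is at most [eps |y - x|]; farther away, the linear growth of rate
    [c] outweighs it once [n |y - x| <= c]. *)
Lemma tilt_min_upper x w (eps : R) : strictly_midconvex -> tilt_min x w ->
  0 < eps -> \forall y \near x, forall w',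
    dotp w' y - H w' <= dotp w y - H w + eps * `|y - x|.
Proof.
move=> scH wmin eps0; pose e := eps / (n%:R + 1).
have n0 : 0 < n%:R + 1 :> R by rewrite ltr_wpDl.
have e0 : 0 < e by rewrite divr_gt0.
have ne : n%:R * e <= eps.
  by rewrite /e mulrA ler_pdivrMr// mulrC ler_wpM2l ?lerDl ?(ltW eps0).
have [c c0 growth] := tilt_min_growth scH wmin e0.
near=> y => w'.
have ny : n%:R * `|y - x| <= c by near: y; exact: near_norm_le.
have := dotp_le_norm (w' - w) (y - x); rewrite !dotpE.
have [ew|/ltW ew] := leP e `|w' - w|.
  have := growth _ ew.
  have : n%:R * (`|w' - w| * `|y - x|) <= c * `|w' - w|.
    by rewrite (mulrC `|w' - w|) mulrA ler_wpM2r.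
  have : 0 <= eps * `|y - x| by rewrite mulr_ge0 ?(ltW eps0).
  lra.
have := wmin w'.
have : n%:R * (`|w' - w| * `|y - x|) <= eps * `|y - x|.
  by rewrite mulrA ler_wpM2r// (le_trans _ ne)// ler_wpM2l.
lra.
Unshelve. all: by end_near. Qed.

(** Bounds on the conjugate at the points [x + d e_i] and [x - d e_i] control each coordinate of
    [w], which makes the tilted function coercive. *)
Lemma tilt_min_exists x :
  (\forall y \near x, exists M, forall w, dotp w y - H w <= M) ->
  exists w, tilt_min x w.
Proof.
move=> /nbhs_ballP[r /= r0 bd]; pose d := r / 2.
have d0 : 0 < d by rewrite divr_gt0.
have bdi (z : 'rV[R]_n) : `|z| <= d ->
    exists M, forall w, dotp w (x + z) - H w <= M.
  move=> zd; apply: bd; rewrite -ball_normE /= opprD addNKr normrN.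
  by rewrite (le_lt_trans zd)// /d ltr_pdivrMr// mulr_natr mulr2n ltrDl.
pose b (i : 'I_n) : 'rV[R]_n := delta_mx ord0 i.
have dotb w i : dotp w (b i) = w ord0 i.
  rewrite /dotp (bigD1 i)//= big1 => [|j ji]; rewrite !mxE !eqxx.
    by rewrite mulr1 addr0.
  by rewrite (negbTE ji) mulr0.
have normb (a : R) i : `|a| <= d -> `|a *: b i| <= d.
  move=> ad; apply: norm_le_coord => [|j]; first exact: ltW.
  rewrite !mxE eqxx /=; case: eqP => _; first by rewrite mulr1.
  by rewrite mulr0 normr0 ltW.
have /choice[M hM] (i : 'I_n) : exists Mi, forall w,
    d * `|w ord0 i| <= H w - dotp w x + Mi.
  have [|M1 hM1] := bdi (d *: b i); first by rewrite normb ?gtr0_norm.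
  have [|M2 hM2] := bdi (- d *: b i).
    by rewrite normb// normrN gtr0_norm.
  exists (`|M1| + `|M2|) => w.
  have := hM1 w; have := hM2 w; rewrite !dotpE dotb.
  have := ler_norm M1; have := ler_norm M2.
  have := normr_ge0 M1; have := normr_ge0 M2.
  by case: (ger0P (w ord0 i)) => _; lra.
have [M0 hM0] : exists M, forall w, dotp w x - H w <= M.
  by have [|M0 hM0] := bdi 0; [rewrite normr0 ltW|exists M0; rewrite addr0 in hM0].
(* The term with [M0] keeps the coercivity bound nonnegative even when there are no coordinates. *)
pose m := `|M0| + \sum_i `|M i|.
have coercive w : d * `|w| <= H w - dotp w x + m.
  rewrite mulrC -ler_pdivlMr//; apply: norm_le_coord => [|i].
    rewrite divr_ge0 ?(ltW d0)// /m.
    have := hM0 w; have := ler_norm M0.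
    have : 0 <= \sum_i `|M i| by exact: sumr_ge0.
    lra.
  rewrite ler_pdivlMr// mulrC (le_trans (hM i w))// lerD2l /m (bigD1 i)//=.
  rewrite (le_trans (ler_norm _))// addrCA lerDl addr_ge0//.
  exact: sumr_ge0.
(* Outside the ball of radius [K], coercivity puts the tilted function above its value at 0. *)
pose K := (H 0 - dotp 0 x + m) / d.
have K0 : 0 <= K.
  by rewrite /K divr_ge0 ?(ltW d0)// -[leLHS](mulr0 d) -(normr0 'rV[R]_n).
pose B := [set w : 'rV[R]_n | `|w| <= K].
have cB : compact B.
  apply: bounded_closed_compact.
    exists K; split; first exact: num_real.
    by move=> k Kk w /= Bw; rewrite (le_trans Bw)// ltW.
  apply: (@closed_comp _ _ (fun v : 'rV[R]_n => `|v|) [set k | k <= K]).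
    move=> v _; exact: norm_continuous.
  exact: closed_le.
have B0 : B 0 by rewrite /B /= normr0.
have [w Bw wmin] := compact_lsc_min cB (ex_intro _ _ B0)
  (@subdifferentiable_tilt_lsc x).
exists w => w'; have [w'K|Kw'] := leP `|w'| K.
  by have := wmin _ w'K; rewrite lee_fin.
have := wmin _ B0; rewrite lee_fin => /le_trans; apply.
have := coercive w'; move: Kw'; rewrite ltr_pdivrMr// mulrC; lra.
Qed.

End TiltedMinimum.

(** * Small steps along rays, and differentiability from a first-order expansion *)

Lemma near_ray {R : realType} {n : nat} (x d : 'rV[R]_n)
    (P : set 'rV[R]_n) :
  nbhs x P -> exists2 t, 0 < t <= 1 & P (x + t *: d).
Proof.
move=> /nbhs_ballP[r /= r0 xP].
have d0 : 0 < `|d| + r by rewrite ltr_wpDl.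
have t0 : 0 < r / (`|d| + r) by rewrite divr_gt0.
exists (r / (`|d| + r)).
  by rewrite t0 ler_pdivrMr// mul1r lerDr normr_ge0.
apply: xP; rewrite -ball_normE /= opprD addNKr normrN mx_normZ gtr0_norm//.
by rewrite mulrAC ltr_pdivrMr// ltr_pM2l// ltrDl.
Qed.

Lemma dotp_continuous {R : realType} {n : nat} (s : 'rV[R]_n) :
  continuous (dotp s).
Proof.
move=> v; apply/(@cvgrPdist_le _ _ _ (nbhs v) (nbhs_filter v)) => e e0.
have := near_norm_le v (mulr_ge0 (ler0n R n) (normr_ge0 s)) e0.
apply: filterS => u; apply: le_trans.
have := dotp_le_norm s (u - v); have := dotp_le_norm s (v - u).
rewrite (distrC v u) -mulrA !dotpE ler_norml; lra.
Qed.

Lemma differentiable_of_linear_expansion {R : realType}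
    {V W : normedModType R} (F : V -> W) (L : {linear V -> W}) (x : V) :
  continuous L ->
  (forall eps : R, 0 < eps ->
    \forall y \near x, `|F y - F x - L (y - x)| <= eps * `|y - x|) ->
  differentiable F x.
Proof.
move=> cL expF.
have oL : F \o shift x = cst (F x) + L +o_ 0 id.
  apply/eqaddoP => eps eps0.
  have /nbhs_ballP[r /= r0 xr] := expF _ eps0.
  apply/nbhs_ballP; exists r => // h; rewrite -ball_normE /= sub0r normrN => hr.
  have := xr (h + x); rewrite -ball_normE /= opprD addrCA subrr addr0 normrN.
  by move=> /(_ hr); rewrite addrK -addrA -opprD.
(* The differential is defined by choice; uniqueness identifies it with [L]. *)
by apply/diff_locallyP; rewrite (diff_unique cL oL).
Qed.

Lemma differentiable_of_expansion {R : realType} {n : nat}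
    (F : 'rV[R]_n -> R) (x s : 'rV[R]_n) :
  (forall eps : R, 0 < eps ->
    \forall y \near x, `|F y - F x - dotp s (y - x)| <= eps * `|y - x|) ->
  differentiable F x.
Proof.
move=> expF.
pose lin := GRing.isLinear.Build R 'rV[R]_n R^o *:%R (dotp s)
  (fun a u v => etrans (dotpDr s (a *: u) v) (congr1 (+%R^~ _) (dotpZr a s u))).
pose L : {linear 'rV[R]_n -> R^o} := HB.pack (dotp s) lin.
apply: (@differentiable_of_linear_expansion R 'rV[R]_n R^o F L) => //.
exact: dotp_continuous.
Qed.

(** * Subgradients and smoothness of the conjugate *)

Section ProxConjugate.
Context {R : realType} {n : nat} (mu : R) (H : 'rV[R]_n -> R).
Hypothesis mu0 : 0 < mu.
Implicit Types w x y s : 'rV[R]_n.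

(* [mu * prox_conjugate x] is the Fenchel conjugate of [H] at [x] minus
   [|x|^2 / 2]. *)
Definition prox_conjugate x : \bar R :=
  ereal_sup (range (fun w => (mu^-1 * (dotp w x - H w - dotp x x / 2))%:E)).

Lemma prox_conjugate_ge w x :
  ((mu^-1 * (dotp w x - H w - dotp x x / 2))%:E <= prox_conjugate x)%E.
Proof. by apply: ereal_sup_ubound; exists w. Qed.

Lemma prox_conjugate_le x (M : R) : (forall w, dotp w x - H w <= M) ->
  (prox_conjugate x <= (mu^-1 * (M - dotp x x / 2))%:E)%E.
Proof.
move=> leM; apply: ge_ereal_sup => _ [w _ <-].
by rewrite lee_fin ler_wpM2l ?invr_ge0 ?(ltW mu0)// lerD2r.
Qed.

Lemma prox_conjugate_tilt_min x w : tilt_min H x w ->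
  prox_conjugate x = (mu^-1 * (dotp w x - H w - dotp x x / 2))%:E.
Proof.
move=> wmin; apply/eqP; rewrite eq_le prox_conjugate_ge andbT.
by apply: prox_conjugate_le => w'; have := wmin w'; lra.
Qed.

Lemma prox_conjugate_gtNy x : (-oo < prox_conjugate x)%E.
Proof. exact: lt_le_trans (ltNyr _) (prox_conjugate_ge 0 x). Qed.

Lemma prox_conjugate_bounded x : edom prox_conjugate x ->
  exists M, forall w, dotp w x - H w <= M.
Proof.
rewrite /edom /= => xlty; have := prox_conjugate_gtNy x.
have := prox_conjugate_ge ^~ x.
case: prox_conjugate xlty => // r _ ler _; exists (mu * r + dotp x x / 2) => w.
by have := ler w; rewrite lee_fin ler_pdivrMl// lerBlDr.
Qed.

(** The term of the supremum given by [w] is a quadratic minorant, exact at [x] with gradient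
    [(w - x) / mu] there. Its second-order part is absorbed in the error. *)
Lemma tilt_min_frechet x w : tilt_min H x w ->
  frechet_subdiff prox_conjugate x (mu^-1 *: (w - x)).
Proof.
move=> wmin eps eps0.
have me0 : 0 < mu * eps by rewrite mulr_gt0.
apply: filterS (near_norm_le x (ler0n R n) me0) => y ny.
apply: le_trans (prox_conjugate_ge w y).
rewrite (prox_conjugate_tilt_min wmin) -EFinD lee_fin.
have : dotp (y - x) (y - x) <= mu * eps * enorm (y - x).
  rewrite -sqr_enorm expr2 ler_wpM2r ?enorm_ge0//.
  exact: le_trans (enorm_le_norm _) ny.
have := dotp_ge0 (y - x); rewrite -subr_ge0 -(pmulr_rge0 _ mu0).
set E := enorm _; rewrite !dotpE (dotpC y x) => d0 dle.
rewrite (_ : mu * _ = dotp w y - dotp y y / 2 - (dotp w x - dotp x x / 2) -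
  (dotp w y - dotp w x - dotp x y + dotp x x) + mu * eps * E); first by lra.
by field; rewrite gt_eqF.
Qed.

Hypothesis subH : subdifferentiable H.

(* The function [y |-> mu * prox_conjugate y + |y|^2 / 2] is convex, which turns
   the local Frechet inequality at [x] into a global one; it is only needed at
   a subgradient [y] of [H] at [w], where the conjugate of [H] is known. *)
Lemma frechet_tilt_min x s : edom prox_conjugate x ->
  frechet_subdiff prox_conjugate x s -> tilt_min H x (mu *: s + x).
Proof.
move=> xdom xs; set w := mu *: s + x.
have ws d : dotp w d = mu * dotp s d + dotp x d by rewrite !dotpE.
clearbody w.
have [y sy] := subH w.
have : (-oo < prox_conjugate x)%E := prox_conjugate_gtNy x.
case phix: (prox_conjugate x) (xdom) => [r| |]//; last by rewrite /edom /= phix.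
move=> _ _.
have ler w' : dotp w' x - H w' <= mu * r + dotp x x / 2.
  have := prox_conjugate_ge w' x; rewrite phix lee_fin ler_pdivrMl//; lra.
have {}sy w' : dotp w' y - H w' <= dotp w y - H w.
  by have := sy w'; rewrite !dotpE (dotpC y w) (dotpC y w'); lra.
(* With [ler], this says that [w] attains the conjugate of [H] at [x]. *)
suff : mu * r + dotp x x / 2 <= dotp w x - H w.
  by move=> h w'; have := ler w'; lra.
apply/ler_addgt0Pr => eps eps0.
(* Chosen so that the Frechet error [eps / k] along [y - x], multiplied by [mu], is at most
   [eps]. *)
pose k := mu * (enorm (y - x) + 1).
have k0 : 0 < k by rewrite mulr_gt0// ltr_wpDl// enorm_ge0.
have [t /andP[t0 t1]] := near_ray (y - x) (xs _ (divr_gt0 eps0 k0)).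
set z := x + t *: (y - x).
(* Convexity of the conjugate of [H] on the segment from [x] to [y], with its value at [y] attained
   at [w]. *)
have zle : (prox_conjugate z <= (mu^-1 * ((1 - t) * (mu * r + dotp x x / 2) +
    t * (dotp w y - H w) - dotp z z / 2))%:E)%E.
  apply: prox_conjugate_le => w'.
  have h1 : (1 - t) * (dotp w' x - H w') <= (1 - t) * (mu * r + dotp x x / 2).
    by rewrite ler_wpM2l ?subr_ge0.
  have h2 : t * (dotp w' y - H w') <= t * (dotp w y - H w).
    by rewrite ler_wpM2l ?(ltW t0).
  by rewrite /z !dotpE; lra.
move=> /le_trans /(_ zle); rewrite phix -EFinD lee_fin ler_pdivlMl//.
rewrite (_ : z - x = t *: (y - x)); last by rewrite /z addrC addKr.
rewrite (enormZ _ (ltW t0)); set E := enorm _.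
have kE : mu * (eps / k * E) <= eps.
  have E1 : 0 < E + 1 by rewrite ltr_wpDl// enorm_ge0.
  rewrite (_ : mu * _ = eps * (E / (E + 1))); last first.
    by rewrite /k -/E; field; rewrite !gt_eqF.
  by rewrite ler_piMr ?(ltW eps0)// ler_pdivrMr// mul1r lerDl.
have tkE : t * (mu * (eps / k * E)) <= t * eps by rewrite ler_wpM2l ?(ltW t0).
have tt : 0 <= t ^+ 2 * dotp (y - x) (y - x).
  by rewrite mulr_ge0 ?sqr_ge0 ?dotp_ge0.
move=> main; rewrite -(ler_pM2l t0).
have wy := ws y; have wx := ws x.
have mwy : t * dotp w y = t * (mu * dotp s y + dotp x y) by rewrite wy.
have mwx : t * dotp w x = t * (mu * dotp s x + dotp x x) by rewrite wx.
move: main tt tkE; rewrite /z !dotpE (dotpC y x); lra.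
Qed.

Hypothesis scH : strictly_midconvex H.

Lemma tilt_min_unique x w1 w2 : tilt_min H x w1 -> tilt_min H x w2 -> w1 = w2.
Proof.
move=> min1 min2; apply: contrapT => /eqP w12.
have := scH w12; have := min1 (2^-1 *: (w1 + w2)).
by have := min2 (2^-1 *: (w1 + w2)); rewrite !dotpE; lra.
Qed.

(** The term given by [w] bounds the conjugate below and [tilt_min_upper] bounds it above; both
    bounds have the same linear part at [x]. *)
Lemma tilt_min_expansion x w (eps : R) : tilt_min H x w -> 0 < eps ->
  \forall y \near x, prox_conjugate y \is a fin_num /\
    `|fine (prox_conjugate y) - fine (prox_conjugate x)
      - dotp (mu^-1 *: (w - x)) (y - x)| <= eps * `|y - x|.
Proof.
move=> wmin eps0; have me0 : 0 < mu * eps by rewrite mulr_gt0.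
apply: filterS2 (near_norm_le x (ler0n R n) me0)
  (tilt_min_upper subH scH wmin me0) => y ny upper.
have : (prox_conjugate y <= _)%E := prox_conjugate_le upper.
have := prox_conjugate_ge w y; rewrite (prox_conjugate_tilt_min wmin)/=.
case: (prox_conjugate y) => [r| |]//=; rewrite !lee_fin => lo up; split=> //.
have dle : dotp (y - x) (y - x) <= mu * eps * `|y - x|.
  by rewrite (le_trans (dotp_le_norm _ _))// mulrA ler_wpM2r.
have mub : mu * dotp (mu^-1 *: (w - x)) (y - x) =
    dotp w y - dotp x y - (dotp w x - dotp x x).
  by rewrite dotpZl mulVKf ?gt_eqF// !dotpE; lra.
have d0 := dotp_ge0 (y - x); rewrite dotpDl !dotpDr !dotpNl !dotpNr (dotpC y x) in d0 dle.
rewrite ler_pdivrMl// in lo; rewrite ler_pdivlMl// in up.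
set N := `|y - x| in dle up *; set b := dotp _ _ in mub *; set a := mu^-1 * _.
have mua : mu * a = dotp w x - H w - dotp x x / 2.
  by rewrite /a mulVKf ?gt_eqF.
rewrite ler_norml; apply/andP; split;
  rewrite -(ler_pM2l mu0); lra.
Qed.

Lemma prox_conjugate_smooth :
  almost_differentiable prox_conjugate /\
  (forall x, (edom prox_conjugate)° x -> differentiable_at prox_conjugate x).
Proof.
have int_min x : (edom prox_conjugate)° x -> exists w, tilt_min H x w.
  move=> xint; apply: tilt_min_exists => //.
  by apply: filterS xint => y; exact: prox_conjugate_bounded.
split; first split.
- exact: prox_conjugate_gtNy.
- move=> x xint; have [w wmin] := int_min x xint.
  exists (mu^-1 *: (w - x)); apply/seteqP; split=> [s xs|_ ->]; last first.
    exact: tilt_min_frechet.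
  rewrite (tilt_min_unique wmin (frechet_tilt_min _ xs)) ?addrK; last first.
    exact: interior_subset xint.
  by rewrite scalerA mulVf ?scale1r ?gt_eqF.
(* A subgradient would yield a minimizer, hence finiteness near [x], and [x] would be interior to
   the domain. *)
- move=> x [xdom]; apply: contra_notP => /eqP/set0P[s xs].
  have wmin := frechet_tilt_min xdom xs.
  apply: filterS (tilt_min_expansion wmin ltr01) => y [+ _].
  by rewrite fin_numE /edom /= ltey => /andP[].
move=> x /int_min[w wmin]; split.
  by apply: filterS (tilt_min_expansion wmin ltr01) => y [].
apply: differentiable_of_expansion => eps eps0.
by apply: filterS (tilt_min_expansion wmin eps0) => y [_]; exact.
Qed.

End ProxConjugate.

(** * Proximal points and the convex function attached to a Moreau envelope *)

Lemma lower_semicontinuousD {R : realType} {T : topologicalType}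
    (f : T -> \bar R) (g : T -> R) :
  lower_semicontinuous f -> lower_semicontinuous (EFin \o g) ->
  lower_semicontinuous (fun x => f x + (g x)%:E)%E.
Proof.
move=> lf lg x a afg.
have [m mf mg] : exists2 m : R, (m%:E < f x)%E & ((a - m)%:E < (g x)%:E)%E.
  case: (f x) afg => [r| |]//; last first.
    by exists (a - g x + 1); rewrite ?ltry// lte_fin; lra.
  rewrite -EFinD lte_fin => arg; exists (r - (r + g x - a) / 2).
    by rewrite lte_fin; lra.
  by rewrite lte_fin; lra.
have [U xU Uf] := lf _ _ mf; have [V xV Vg] := lg _ _ mg.
exists (U `&` V); first exact: filterI.
move=> y [/Uf + /Vg]; rewrite /= lte_fin.
case: (f y) => [r| |]//; last by move=> _ _; rewrite addye ?ltry.
by rewrite -EFinD !lte_fin; lra.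
Qed.

Section ProximalPoints.
Context {R : realType} {n : nat} (mu : R) (f : 'rV[R]_n -> \bar R).
Hypothesis mu0 : 0 < mu.
Implicit Types v w x y s : 'rV[R]_n.

Definition proximal_point x y := f y \is a fin_num /\
  moreau_env mu f x = (fine (f y) + (2 * mu)^-1 * enorm (y - x) ^+ 2)%:E.

Lemma quadratic_lsc x (c : R) : 0 <= c ->
  lower_semicontinuous (EFin \o (fun w => c * enorm (w - x) ^+ 2)).
Proof.
move=> c0; pose Q w := c * enorm (w - x) ^+ 2.
have subQ : subdifferentiable Q.
  move=> w; exists ((2 * c) *: (w - x)) => w'.
  have := mulr_ge0 c0 (dotp_ge0 (w' - w)).
  rewrite /Q !sqr_enorm !dotpE (dotpC w' w) (dotpC w' x) (dotpC x w); lra.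
have := subdifferentiable_tilt_lsc subQ (x := 0).
congr lower_semicontinuous; apply/funext => w /=.
by rewrite -(scale0r (0 : 'rV[R]_n)) dotpZr mul0r subr0.
Qed.

(** Some [la > mu] has a finite lower bound for its envelope at a point, so [f] is minorized by a
    quadratic of curvature weaker than that of the proximal term. The sum is coercive and attains
    its minimum. *)
Lemma proximal_point_exists : proper_efun f -> lower_semicontinuous f ->
  (mu%:E < prox_threshold f)%E -> forall x, exists y, proximal_point x y.
Proof.
move=> [fNy [w0 /= fw0]] lscf /ereal_sup_gt[_ [la [la0 [x0 ex0]] <-]].
rewrite lte_fin => mula x.
set c := (2 * mu)^-1; pose B := (2 * la)^-1.
have B0 : 0 < B by rewrite invr_gt0 mulr_gt0.
have Bc : B < c by rewrite ltf_pV2 ?posrE ?mulr_gt0// ltr_pM2l.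
have c0 : 0 < c by exact: lt_trans Bc.
have [b lowf] : exists b, forall w, ((b - B * enorm (w - x0) ^+ 2)%:E <= f w)%E.
  have [b bex0] : exists b : R, (b%:E < moreau_env la f x0)%E.
    case: moreau_env ex0 => [r _|_|//]; last by exists 0; rewrite ltry.
    by exists (r - 1); rewrite lte_fin; lra.
  exists b => w; have := fNy w.
  have := lt_le_trans bex0 (ereal_inf_lbound (ex_intro2 _ _ w I erefl)).
  case: (f w) => [r| |]//; last by rewrite leey.
  by rewrite -EFinD lte_fin lee_fin -/B; lra.
pose F w := (f w + (c * enorm (w - x) ^+ 2)%:E)%E.
(* The parameter of Young's inequality for [|(w - x) + (x - x0)|^2]: since [B d = k], half of the
   gap [c - B] is spent and the other half remains as the coercivity rate [k]. *)
pose d := (c - B) / (2 * B).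
have d0 : 0 < d by rewrite divr_gt0 ?subr_gt0// mulr_gt0.
pose k := (c - B) / 2.
have k0 : 0 < k by rewrite divr_gt0 ?subr_gt0.
pose C := b - B * (1 + d^-1) * dotp (x - x0) (x - x0).
have coercive w : ((C + k * `|w - x| ^+ 2)%:E <= F w)%E.
  have := lowf w; rewrite /F; have := fNy w.
  case: (f w) => [r| |]// _; last by move=> _; rewrite addye ?leey.
  rewrite -EFinD !lee_fin !sqr_enorm.
  have h1 : k * `|w - x| ^+ 2 <= k * dotp (w - x) (w - x).
    by rewrite ler_wpM2l ?(ltW k0)// sqr_norm_le_dotp.
  have h3 : 0 <= B * d^-1 * dotp (d *: (w - x) - (x - x0)) (d *: (w - x) - (x - x0)).
    exact: mulr_ge0 (divr_ge0 (ltW B0) (ltW d0)) (dotp_ge0 _).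
  rewrite (_ : w - x0 = (w - x) + (x - x0)); last by rewrite addrA subrK.
  rewrite /C; move: (w - x) (x - x0) h1 h3 => u e h1 h3.
  move: h3; rewrite !dotpE (dotpC e u).
  rewrite (_ : B * d^-1 * _ = B * d * dotp u u - 2 * B * dotp u e
    + B * d^-1 * dotp e e); last by field; rewrite gt_eqF.
  have -> : B * d = k by rewrite /d /k; field; rewrite gt_eqF.
  rewrite /k in h1 *; lra.
have F0fin : F w0 \is a fin_num.
  by rewrite fin_numD andbT fin_numElt fNy.
set v0 := fine (F w0).
(* The ball of radius [M] contains [w0]; beyond it [|w - x| >= 1], so
   [k |w - x|^2 >= k |w - x| >= |v0 - C|]. *)
pose M := `|w0 - x| + `|v0 - C| / k + 1.
have q0 : 0 <= `|v0 - C| / k by rewrite divr_ge0 ?(ltW k0).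
pose A := [set w : 'rV[R]_n | `|w - x| <= M].
have cA : compact A.
  apply: bounded_closed_compact.
    exists (M + `|x|); split; first exact: num_real.
    move=> m ltm v /= Av; rewrite -(subrK x v) (le_trans (ler_normD _ _))//.
    by apply: ltW; apply: le_lt_trans ltm; rewrite lerD2r.
  apply: (@closed_comp _ _ (fun v : 'rV[R]_n => `|v - x|) [set m | m <= M]).
    by move=> v _; exact: continuous_norm_sub.
  exact: closed_le.
have Aw0 : A w0 by rewrite /A /= /M -addrA lerDl addr_ge0.
have lscF : lower_semicontinuous F.
  by apply: lower_semicontinuousD => //; exact: quadratic_lsc (ltW c0).
have [y Ay ymin] := compact_lsc_min cA (ex_intro _ _ Aw0) lscF.
have Fmin w : (F y <= F w)%E.
  have [wM|Mw] := leP `|w - x| M; first exact: ymin.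
  apply: le_trans (ymin _ Aw0) _; apply: le_trans (coercive w).
  rewrite -(fineK F0fin) lee_fin -/v0.
  have N0 := normr_ge0 (w0 - x).
  have : `|v0 - C| <= k * `|w - x|.
    by rewrite mulrC -ler_pdivrMr//; move: Mw; rewrite /M; lra.
  have : k * `|w - x| <= k * `|w - x| ^+ 2.
    rewrite ler_pM2l// expr2 ler_peMl//; move: Mw; rewrite /M; lra.
  have := ler_norm (v0 - C); lra.
have fyfin : f y \is a fin_num.
  have Fw0 : (F w0 < +oo)%E by rewrite ltey_eq F0fin.
  have := le_lt_trans (Fmin w0) Fw0; rewrite /F fin_numElt fNy.
  by case: (f y) => [r| |]; rewrite ?addye ?ltxx ?ltry ?ltNyr ?ltNyy.
exists y; split=> //; apply/eqP; rewrite eq_le; apply/andP; split.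
  by rewrite EFinD fineK//; apply: ereal_inf_lbound; exists y.
apply: le_ereal_inf_tmp => _ [w _ <-].
by rewrite EFinD fineK//; exact: Fmin.
Qed.

Lemma proximal_point_le x y w : proximal_point x y ->
  ((fine (f y) + (2 * mu)^-1 * enorm (y - x) ^+ 2)%:E <=
   f w + ((2 * mu)^-1 * enorm (w - x) ^+ 2)%:E)%E.
Proof. by move=> [_ <-]; apply: ereal_inf_lbound; exists w. Qed.

(** Expanding the squares in the minimality of [y] leaves a linear minorant of [f] at [y] up to
    [|v - y|^2 / (2 mu)]. *)
Lemma proximal_point_frechet x y : proximal_point x y ->
  frechet_subdiff f y (mu^-1 *: (x - y)).
Proof.
move=> xy eps eps0; have me0 : 0 < mu * eps by rewrite mulr_gt0.
apply: filterS (near_norm_le y (ler0n R n) me0) => v nv.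
have := proximal_point_le v xy; case: xy => fy _; rewrite -{2}(fineK fy) -EFinD.
case: (f v) => [r| |]//; last by move=> _; rewrite leey.
rewrite -EFinD !lee_fin => main; rewrite -subr_ge0; rewrite -subr_ge0 in main.
have dle : dotp (v - y) (v - y) <= mu * eps * enorm (v - y).
  rewrite -sqr_enorm expr2 ler_wpM2r ?enorm_ge0//.
  exact: le_trans (enorm_le_norm _) nv.
have d0 := dotp_ge0 (v - y); move: main.
rewrite -(pmulr_rge0 _ mu0) -[X in _ -> is_true X](pmulr_rge0 _ mu0).
set E := enorm (v - y) in dle *.
rewrite (_ : mu * _ = mu * r - mu * fine (f y)
  + dotp (v - x) (v - x) / 2 - dotp (y - x) (y - x) / 2); last first.
  by rewrite !sqr_enorm; field; rewrite gt_eqF.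
rewrite (_ : mu * (r - _) = mu * r - mu * fine (f y) - dotp (x - y) (v - y)
  + mu * eps * E); last by rewrite dotpZl; field; rewrite gt_eqF.
move: d0 dle; rewrite !dotpE (dotpC x v) (dotpC y v) (dotpC x y); lra.
Qed.

Hypothesis prox_ex : forall x, exists y, proximal_point x y.

(* [mu] times the conjugate of [f + |.|^2 / (2 mu)], evaluated at [w / mu]. *)
Definition env_conjugate w : R :=
  dotp w w / 2 - mu * fine (moreau_env mu f w).

Lemma moreau_env_fin_num x : moreau_env mu f x \is a fin_num.
Proof. by have [y [_ ->]] := prox_ex x. Qed.

Lemma env_conjugate_proximal_point w y : proximal_point w y ->
  env_conjugate w = dotp y w - mu * fine (f y) - dotp y y / 2.
Proof.
move=> [_ envw]; rewrite /env_conjugate envw /= sqr_enorm !dotpE (dotpC w y).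
by field; rewrite gt_eqF.
Qed.

(** The Fenchel-Young inequality; proximal points of [w] are its equality case. *)
Lemma env_conjugate_ge w y : f y \is a fin_num ->
  dotp y w - mu * fine (f y) - dotp y y / 2 <= env_conjugate w.
Proof.
move=> fy; have [z wz] := prox_ex w.
rewrite (env_conjugate_proximal_point wz).
have := proximal_point_le y wz; rewrite -(fineK fy) -EFinD lee_fin /=.
rewrite -(ler_pM2l mu0) !sqr_enorm !mulrDr !mulrA.
rewrite (_ : mu / (2 * mu) = 2^-1); last by field; rewrite gt_eqF.
rewrite !dotpE (dotpC w y) (dotpC w z); lra.
Qed.

Lemma env_conjugate_subdifferentiable : subdifferentiable env_conjugate.
Proof.
move=> w; have [y wy] := prox_ex w; exists y => w'.
rewrite (env_conjugate_proximal_point wy).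
have := env_conjugate_ge w' (proj1 wy); rewrite !dotpE; lra.
Qed.

(* If [env_conjugate] is affine between [w1] and [w2], a proximal point [y] of
   the midpoint is a proximal point of both [w1] and [w2], so that
   [(w1 - y) / mu] and [(w2 - y) / mu] are both subgradients of [f] at [y]. *)
Lemma env_conjugate_strictly_midconvex :
  (forall y s1 s2, edom f y -> frechet_subdiff f y s1 ->
    frechet_subdiff f y s2 -> s1 = s2) ->
  strictly_midconvex env_conjugate.
Proof.
move=> uniq_sub w1 w2 /eqP w12; set m := 2^-1 *: (w1 + w2).
have [y my] := prox_ex m; have fy := proj1 my.
rewrite ltNge; apply/negP => le_mid; apply: w12.
(* The right-hand sides of [e1] and [e2] average to the value at [m], so [le_mid] forces equality in
   both. *)
have e1 := env_conjugate_ge w1 fy; have e2 := env_conjugate_ge w2 fy.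
rewrite (env_conjugate_proximal_point my) /m !dotpE in le_mid.
have prox_of w : env_conjugate w <= dotp y w - mu * fine (f y) - dotp y y / 2 ->
    proximal_point w y.
  move=> ew; split => //; have {ew}ew := le_anti (introT andP (conj ew (env_conjugate_ge w fy))).
  rewrite -(fineK (moreau_env_fin_num w)); congr EFin.
  apply: (mulfI (lt0r_neq0 mu0)).
  move: ew; rewrite /env_conjugate sqr_enorm mulrDr mulrA.
  rewrite (_ : mu / (2 * mu) = 2^-1); last by field; rewrite gt_eqF.
  rewrite !dotpE (dotpC w y); lra.
have p1 : proximal_point w1 y by apply: prox_of; lra.
have p2 : proximal_point w2 y by apply: prox_of; lra.
have ydom : edom f y by move: fy; rewrite fin_numElt => /andP[].
have := uniq_sub _ _ _ ydom (proximal_point_frechet p1) (proximal_point_frechet p2).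
by move=> /(scalerI (invr_neq0 (lt0r_neq0 mu0))) /addIr.
Qed.

End ProximalPoints.

(** * Convexity and strict convexity of weighted sums *)

Section ConvexCombination.
Context {R : realType} {n : nat} (K1 K2 : 'rV[R]_n -> R) (a b : R).
Hypotheses (sub1 : subdifferentiable K1) (sub2 : subdifferentiable K2).

Lemma subdifferentiable_comb : 0 <= a -> 0 <= b ->
  subdifferentiable (fun w => a * K1 w + b * K2 w).
Proof.
move=> a0 b0 w; have [y1 sy1] := sub1 w; have [y2 sy2] := sub2 w.
exists (a *: y1 + b *: y2) => w'; rewrite dotpDl !dotpZl.
by have := ler_wpM2l a0 (sy1 w'); have := ler_wpM2l b0 (sy2 w'); lra.
Qed.

Lemma strictly_midconvex_comb : 0 < a -> 0 <= b -> strictly_midconvex K1 ->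
  strictly_midconvex (fun w => a * K1 w + b * K2 w).
Proof.
move=> a0 b0 sc1 w1 w2 w12; set m := 2^-1 *: _.
have t01 : 0 <= (2^-1 : R) <= 1 by apply/andP; split; lra.
have := subdifferentiable_convex sub2 w1 w2 t01.
have -> : w1 + 2^-1 *: (w2 - w1) = m.
  rewrite /m scalerBr scalerDr addrCA addrC; congr (_ + _).
  by rewrite -{1}[w1]scale1r -scalerBl; congr (_ *: _); lra.
move=> /(ler_wpM2l b0); have := sc1 _ _ w12.
by rewrite -(ltr_pM2l a0) -/m; lra.
Qed.

End ConvexCombination.

(** * Uniqueness of Frechet subgradients *)

Lemma frechet_subdiff_unique {R : realType} {n : nat} (f : 'rV[R]_n -> \bar R) :
  almost_differentiable f \/ (forall x, edom f x -> differentiable_at f x) ->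
  forall x s1 s2, edom f x -> frechet_subdiff f x s1 ->
    frechet_subdiff f x s2 -> s1 = s2.
Proof.
move=> [[_ fint fbd]|fdiff] x s1 s2 xdom xs1 xs2.
  have [/fint[s xs]|xnint] := pselect ((edom f)° x).
    by move: xs1 xs2; rewrite xs => -> ->.
  by move: xs1; rewrite fbd.
have [ffin df] := fdiff x xdom.
have fx : f x \is a fin_num by exact: nbhs_singleton ffin.
pose L : 'rV[R]_n -> R := 'd (fun y => fine (f y)) x.
have LN d : L (- d) = - L d by rewrite /L linearN.
have LZ t d : L (t *: d) = t * L d by rewrite /L linearZ.
(* The Frechet inequality and the differential are compared at [x + t d] and divided by [t]; using
   [- d] as well then gives equality. *)
have gradL s d : frechet_subdiff f x s -> dotp s d <= L d.
  move=> xs; apply/ler_addgt0Pr => eps eps0.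
  pose k := enorm d + `|d| + 1.
  have k0 : 0 < k by rewrite ltr_wpDl// addr_ge0// enorm_ge0.
  have e0 : 0 < eps / k by rewrite divr_gt0.
  have [_ dfx] := (iffLR (diff_locallyP _ _)) df.
  have dfe : \forall y \near x, fine (f y) - fine (f x) - L (y - x)
      <= eps / k * `|y - x|.
    have /nbhs_ballP[r /= r0 hr] := (iffLR (eqaddoP _ _ _ _) dfx) _ e0.
    apply/nbhs_ballP; exists r => // y; rewrite -ball_normE /= distrC => yr.
    have := hr (y - x); rewrite -ball_normE /= sub0r normrN => /(_ yr).
    rewrite -[X in `|X|]/(fine (f (y - x + x)) - (fine (f x) + L (y - x))).
    by rewrite subrK opprD addrA; apply: le_trans; exact: ler_norm.
  have [t /andP[t0 _] [[ft st] dt]] :=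
    near_ray d (filterI (filterI ffin (xs _ e0)) dfe).
  move: st dt; rewrite -(fineK fx) -(fineK ft) -EFinD lee_fin /=.
  rewrite [x + _]addrC addrK enormZ ?(ltW t0)// mx_normZ gtr0_norm//.
  rewrite dotpZr LZ => st dt.
  rewrite -(ler_pM2l t0).
  have : eps / k * (enorm d + `|d|) <= eps.
    rewrite mulrAC ler_pdivrMr// ler_wpM2l ?(ltW eps0)// /k lerDl//.
  move=> /(ler_wpM2l (ltW t0)).
  lra.
have eqL s d : frechet_subdiff f x s -> dotp s d = L d.
  move=> xs; apply/eqP; rewrite eq_le gradL//=.
  by have := gradL s (- d) xs; rewrite LN dotpNr lerN2.
apply/eqP; rewrite -subr_eq0; apply/eqP; apply: dotp_eq0.
by rewrite dotpDl dotpNl !eqL// subrr.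
Qed.

Theorem corollary8p7 (R : realType) (n : nat) (f g : 'rV[R]_n -> \bar R)
    (mu alpha : R) :
  proper_efun f -> proper_efun g ->
  lower_semicontinuous f -> lower_semicontinuous g ->
  prox_bounded f -> prox_bounded g ->
  0 < mu -> (mu%:E < Order.min (prox_threshold f) (prox_threshold g))%E ->
  0 <= alpha <= 1 ->
  (0 < alpha /\
     (almost_differentiable f \/ (forall x, edom f x -> differentiable_at f x)))
  \/ (alpha < 1 /\
     (almost_differentiable g \/ (forall x, edom g x -> differentiable_at g x))) ->
  almost_differentiable (nc_prox_average mu alpha f g) /\
  (forall x, (edom (nc_prox_average mu alpha f g))° x ->
     differentiable_at (nc_prox_average mu alpha f g) x).
Proof.
move=> propf propg lscf lscg _ _ mu0; rewrite lt_min => /andP[muf mug].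
move=> /andP[alpha0 alpha1] smooth.
have beta0 : 0 <= 1 - alpha by rewrite subr_ge0.
have proxf := proximal_point_exists mu0 propf lscf muf.
have proxg := proximal_point_exists mu0 propg lscg mug.
have subf := env_conjugate_subdifferentiable mu0 proxf.
have subg := env_conjugate_subdifferentiable mu0 proxg.
pose H w := alpha * env_conjugate mu f w + (1 - alpha) * env_conjugate mu g w.
(* The outer negation turns the infimum into a supremum, and expanding [|w - x|^2 / (2 mu)] gives
   the terms of [prox_conjugate]. *)
have -> : nc_prox_average mu alpha f g = prox_conjugate mu H.
  apply/funext => x; rewrite /nc_prox_average {1}/moreau_env -ereal_supN image_comp.
  congr ereal_sup; apply: eq_imagel => w _ /=.
  have /fineK <- := moreau_env_fin_num proxf w.
  have /fineK <- := moreau_env_fin_num proxg w.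
  rewrite -!EFinM -!EFinN; congr EFin.
  rewrite /H /env_conjugate sqr_enorm !dotpE (dotpC x w).
  by field; rewrite gt_eqF.
apply: prox_conjugate_smooth => //; first exact: subdifferentiable_comb.
(* Strict convexity comes from the summand that has unique subgradients and a positive weight; the
   other need only be convex. *)
case: smooth => [[a0 /frechet_subdiff_unique uf]|[a1 /frechet_subdiff_unique ug]].
  by apply: strictly_midconvex_comb => //; exact: env_conjugate_strictly_midconvex.
rewrite (_ : H = fun w => (1 - alpha) * env_conjugate mu g w +
  alpha * env_conjugate mu f w); last by apply/funext => w; rewrite addrC.
apply: strictly_midconvex_comb => //; first by rewrite subr_gt0.
exact: env_conjugate_strictly_midconvex.
Qed.
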